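(* Let $E:\ a_1x_1+a_2x_2+a_3x_3+a_4x_4=0$ be an invariant homogeneous linear equation in $4$ variables, i.e. $a_1,a_2,a_3,a_4$ are nonzero integers with $a_1+a_2+a_3+a_4=0$. If $E$ is sparse, then $E$ is abundant. More precisely, if $C>0$ is such that $R_E(\varepsilon)\le \varepsilon^{-C}$ (for all sufficiently small $\varepsilon>0$), then $R^*_E(\varepsilon)\ge \frac12\varepsilon^{8C}$ for all sufficiently small $\varepsilon>0$.
   Context: For $n\in\mathbb{N}$ write $[n]=\{1,\dots,n\}$. For $0<\varepsilon\le 1$, $R_E(\varepsilon)$ denotes the smallest integer $R$ such that for every $n\ge R$, every set $S\subseteq[n]$ with $|S|=\varepsilon n$ (equivalently, $|S|\ge \varepsilon n$) contains a solution $(x_1,x_2,x_3,x_4)$ of $E$ with $x_1,x_2,x_3,x_4$ pairwise distinct elements of $S$. The equation $E$ is called sparse if there is a constant $C=C(E)$ with $R_E(\varepsilon)\le \varepsilon^{-C}$ for all sufficiently small $\varepsilon>0$. For an equation in $k$ variables, $R^*_E(\varepsilon)$ denotes the largest number such that every $S\subseteq[n]$ with $|S|=\varepsilon n$ contains at least $(R^*_E(\varepsilon)-o_n(1))\cdot n^{k-1}$ solutions of $E$ (tuples of elements of $S$ satisfying $E$), where $o_n(1)$ is a quantity tending to $0$ as $n\to\infty$; equivalently $R^*_E(\varepsilon)=\liminf_{n\to\infty}\min_{S\subseteq[n],\,|S|\ge\varepsilon n} \#\{\text{solutions of } E \text{ in } S\}/n^{k-1}$. Here $k=4$. The equation $E$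 is called abundant if there is a constant $C'=C'(E)$ with $R^*_E(\varepsilon)\ge\varepsilon^{C'}$ for all sufficiently small $\varepsilon>0$. *)

(* Defs.v *)
From HB Require Import structures.
From mathcomp Require Import all_boot all_order all_algebra.
From mathcomp Require Import all_classical all_reals all_analysis.
Set Implicit Arguments. Unset Strict Implicit. Unset Printing Implicit Defensive.
Import Order.TTheory GRing.Theory Num.Theory.
Local Open Scope ring_scope.

(* [n] = {1,...,n} is represented by 'I_n, the element i : 'I_n standing
   for the integer (val i + 1). *)
Definition elt (n : nat) (i : 'I_n) : int := ((val i).+1)%:Z.

Definition solE (a1 a2 a3 a4 : int) (n : nat) (x1 x2 x3 x4 : 'I_n) : bool :=
  a1 * elt x1 + a2 * elt x2 + a3 * elt x3 + a4 * elt x4 == 0.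

Definition has_distinct_sol (a1 a2 a3 a4 : int) (n : nat) (S : {set 'I_n}) : Prop :=
  exists x1 x2 x3 x4 : 'I_n,
    [/\ [&& x1 \in S, x2 \in S, x3 \in S & x4 \in S],
        [&& x1 != x2, x1 != x3, x1 != x4, x2 != x3, x2 != x4 & x3 != x4]
      & solE a1 a2 a3 a4 x1 x2 x3 x4].

(* "R_E(eps) <= x": R_E(eps) is the smallest integer R with the property
   below; it is <= x iff some integer R <= x has the property. *)
Definition RE_le (R : realType) (a1 a2 a3 a4 : int) (eps x : R) : Prop :=
  exists R0 : nat, (R0%:R <= x) /\
    forall n : nat, (R0 <= n)%N -> forall S : {set 'I_n},
      eps * n%:R <= #|S|%:R -> has_distinct_sol a1 a2 a3 a4 S.

Definition nsol (a1 a2 a3 a4 : int) (n : nat) (S : {set 'I_n}) : nat :=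
  #|[set x : 'I_n * 'I_n * 'I_n * 'I_n |
      [&& x.1.1.1 \in S, x.1.1.2 \in S, x.1.2 \in S, x.2 \in S &
          solE a1 a2 a3 a4 x.1.1.1 x.1.1.2 x.1.2 x.2]]|.

Definition min_ratio (R : realType) (a1 a2 a3 a4 : int) (eps : R) (n : nat) : R :=
  inf [set (nsol a1 a2 a3 a4 S)%:R / (n%:R ^+ 3) | S in
        [set S : {set 'I_n} | eps * n%:R <= #|S|%:R]].

Definition Rstar (R : realType) (a1 a2 a3 a4 : int) (eps : R) : R :=
  limn_inf (min_ratio a1 a2 a3 a4 eps).

(* Main.v *)
Require Import Defs.
From HB Require Import structures.
From mathcomp Require Import all_boot all_order all_algebra.
From mathcomp Require Import all_classical all_reals all_analysis.
From mathcomp Require Import zify ring lra.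
Import Order.TTheory GRing.Theory Num.Theory.
Local Open Scope ring_scope.

(* Take a set X of points y in [0, l)^d lying on a common sphere. Reading the
   coordinates of y as digits in base K l, K = |a1| + ... + |a4|, embeds X in
   [0, (K l)^d) so that every solution of E in the image comes from a
   coordinatewise solution in X. Map X to the integers by a random affine map
   y |-> x0 - <h, y>, and let A be the set of y in X sent into S. No three
   points of X are collinear, so the three images of distinct points vary
   almost independently, and a given distinct solution in X lands in S with
   probability O(T / n^3), T being the number of solutions in S. If T were
   small, deleting one point per solution would leave a subset of A with no
   distinct solution, yet of density about eps l^(-3) in [0, (K l)^d),
   contradicting sparsity once l = eps^(-2C/d) with d >= 12 C. *)

(** * Digit expansions with signed coefficients *)

(** Modulo [b], the lowest coefficient is divisible by [b] but smaller than [b] in absolute value,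
    so it vanishes; dividing by [b] leaves the same problem for the higher ones. Signs are allowed
    because the coefficients will be linear combinations of digits. *)
Lemma base_expansion_eq0 (b d : nat) (c : 'I_d -> int) :
  (forall i, (`|c i| < b)%N) ->
  \sum_(i < d) c i * (b ^ i)%:Z = 0 -> forall i, c i = 0.
Proof.
elim: d c => [|d IH] c hc; first by move=> _ [].
rewrite big_ord_recl expn0 mulr1 => h0.
set r := \sum_(i < d) c (lift ord0 i) * (b ^ i)%:Z.
have E : c ord0 + b%:Z * r = 0.
  rewrite -[RHS]h0 mulr_sumr; congr (_ + _); apply: eq_bigr => i _.
  by rewrite lift0 expnS PoszM; ring.
have c0 : c ord0 = 0.
  have := hc ord0; have : (b %| `|c ord0|)%N.
    apply/dvdnP; exists `|r|%N.
    have -> : c ord0 = - (b%:Z * r) by move: E; lia.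
    by rewrite abszN abszM mulnC.
  move=> /dvdn_leq h1 h2; apply/eqP; rewrite -absz_eq0 -leqn0 leqNgt.
  by apply/negP => /h1; lia.
have r0 : r = 0.
  move: E; rewrite c0 add0r => /eqP; rewrite mulf_eq0 => /orP[/eqP b0|/eqP //].
  by have := hc ord0; lia.
move=> i; case: (unliftP ord0 i) => [j|] -> //.
by apply: (IH (fun j => c (lift ord0 j))) => // k; apply: hc.
Qed.

Lemma base_expansion_lt (b d : nat) (c : 'I_d -> nat) :
  (forall i, (c i < b)%N) -> (\sum_(i < d) c i * b ^ i < b ^ d)%N.
Proof.
elim: d c => [|d IH] c hc; first by rewrite big_ord0.
rewrite big_ord_recl expn0 muln1.
set r := (\sum_(i < d) c (lift ord0 i) * b ^ i)%N.
have E : (\sum_(i < d) c (lift ord0 i) * b ^ lift ord0 i = b * r)%N.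
  rewrite /r big_distrr; apply: eq_bigr => i _ /=.
  by rewrite /bump leq0n add1n expnS mulnCA.
have hr : (r < b ^ d)%N by apply: IH => i; apply: hc.
rewrite E expnS; have h0 := hc ord0.
apply: (@leq_trans (b * r.+1)%N); first by rewrite mulnS; lia.
by rewrite leq_mul2l hr orbT.
Qed.

(** * Points on a sphere: noncollinearity and a popular radius *)

(* A line meets a sphere in at most two points. *)
Lemma sphere_noncollinear (d : nat) (x y z : 'I_d -> int) (r : int) :
  \sum_i x i ^+ 2 = r -> \sum_i y i ^+ 2 = r -> \sum_i z i ^+ 2 = r ->
  ~ x =1 y -> ~ x =1 z -> ~ y =1 z ->
  exists i j, (y i - x i) * (z j - x j) - (y j - x j) * (z i - x i) != 0.
Proof.
move=> hx hy hz nxy nxz nyz; apply: contrapT => Hno.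
pose u i := y i - x i; pose v i := z i - x i.
(* All minors vanish, so [u] and [v] are proportional; the argument stays over the integers by
   cross-multiplying. *)
have H i j : u i * v j = u j * v i.
  apply/eqP; rewrite -subr_eq0; apply: contrapT => /negP D.
  by apply: Hno; exists i, j.
have [i ui] : exists i, u i != 0.
  apply: contrapT => N; apply: nxy => i; apply/eqP.
  rewrite eq_sym -subr_eq0; apply: contrapT => /negP D.
  by apply: N; exists i.
have vi : v i != 0.
  apply/eqP => vi; apply: nxz => j; have := H i j.
  rewrite vi mulr0 => /eqP; rewrite mulf_eq0 (negbTE ui) /= subr_eq0.
  by move/eqP.
pose U := \sum_j u j ^+ 2; pose W := \sum_j x j * u j.
have eU : U = - (2 * W).
  have : \sum_j y j ^+ 2 = \sum_j x j ^+ 2 + 2 * W + U.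
    rewrite /W /U mulr_sumr -!big_split; apply: eq_bigr => j _ /=.
    by rewrite /u; ring.
  by rewrite hx hy; lia.
have eV : \sum_j v j ^+ 2 = - (2 * \sum_j x j * v j).
  have : \sum_j z j ^+ 2 = \sum_j x j ^+ 2 + 2 * (\sum_j x j * v j) + \sum_j v j ^+ 2.
    rewrite mulr_sumr -!big_split; apply: eq_bigr => j _ /=.
    by rewrite /v; ring.
  by rewrite hx hz; lia.
have e1 : u i ^+ 2 * \sum_j v j ^+ 2 = v i ^+ 2 * U.
  rewrite /U !mulr_sumr; apply: eq_bigr => j _.
  by rewrite -!exprMn H mulrC.
have e2 : u i * \sum_j x j * v j = v i * W.
  rewrite /W !mulr_sumr; apply: eq_bigr => j _.
  by rewrite mulrCA H; ring.
(* With [v = t u], lying on the sphere gives both [|u|^2 = -2 <x, u>] and [t^2 |u|^2 = -2 t <x, u>],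
   hence [t (t - 1) |u|^2 = 0]. As [t] and [|u|] are nonzero, [t = 1] and [y = z]. *)
have e3 : v i * U * (v i - u i) = 0.
  have -> : v i * U * (v i - u i) = v i ^+ 2 * U - u i * v i * U by ring.
  by rewrite -e1 eV eU mulrN [u i ^+ 2 * _]mulrCA expr2 -[u i * u i * _]mulrA e2; ring.
have U0 : U != 0.
  have : 0 < U; last by move/lt0r_neq0.
  rewrite /U (bigD1 i) //= ltr_wpDr //; last by rewrite exprn_even_gt0.
  by apply: sumr_ge0 => j _; exact: sqr_ge0.
move/eqP: e3; rewrite !mulf_eq0 (negbTE vi) (negbTE U0) /= subr_eq0 => /eqP e3.
apply: nyz => j; have := H i j; rewrite e3 [u j * _]mulrC => /(mulfI ui).
by rewrite /u /v => /addIr.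
Qed.

(** The squared norm takes at most [1 + d l^2] values on the cube, so some sphere holds at least the
    average number of points. *)
Lemma sphere_pigeonhole (d l : nat) : exists r : nat,
  (l ^ d <= #|[set y : {ffun 'I_d -> 'I_l} | \sum_i y i ^ 2 == r]| * (1 + d * l ^ 2))%N.
Proof.
pose f (y : {ffun 'I_d -> 'I_l}) := (\sum_i y i ^ 2)%N.
have hf y : (f y < (d * l ^ 2).+1)%N.
  rewrite ltnS -[d in (_ <= d * _)%N]card_ord -sum_nat_const; apply: leq_sum => i _.
  by rewrite leq_exp2r // ltnW.
pose g y : 'I_((d * l ^ 2).+1) := Ordinal (hf y).
apply: contrapT => N.
have E : (\sum_(r < (d * l ^ 2).+1) #|[set y | f y == r]| = l ^ d)%N.
  have -> : (l ^ d = #|{ffun 'I_d -> 'I_l}|)%N by rewrite card_ffun !card_ord.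
  rewrite -sum1_card (partition_big g predT) //=; apply: eq_bigr => r _.
  rewrite -sum1_card; apply: eq_bigl => y; rewrite inE.
  by apply/eqP/eqP => [h|<- //]; apply: val_inj.
(* The [+ 1] on each fibre records a strict inequality, which makes the summed bound
   contradictory. *)
have : (\sum_(r < (d * l ^ 2).+1) (#|[set y | f y == r]| * (1 + d * l ^ 2) + 1)
        <= \sum_(r < (d * l ^ 2).+1) l ^ d)%N.
  apply: leq_sum => r _; rewrite addn1 ltnNge; apply/negP => h; apply: N; by exists r.
by rewrite big_split /= -big_distrl /= E !sum_nat_const card_ord; lia.
Qed.

(** * Counting affine maps that send given points into [S] *)

Definition inner {n l d : nat} (h : {ffun 'I_d -> 'I_n}) (y : {ffun 'I_d -> 'I_l}) : nat :=
  (\sum_i h i * y i)%N.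

(* The preimage of S under y |-> z.1 - <z.2, y>, written without truncated
   subtraction. *)
Definition affine_preim {n l d N : nat} (S : {set 'I_n})
    (z : 'I_N * {ffun 'I_d -> 'I_n}) : {set {ffun 'I_d -> 'I_l}} :=
  [set y | [exists s in S, s + inner z.2 y == z.1]%N].

Lemma inner_le {n l d : nat} (h : {ffun 'I_d -> 'I_n}) (y : {ffun 'I_d -> 'I_l}) :
  (inner h y <= d * l * n)%N.
Proof.
rewrite /inner -mulnA -[d in (_ <= d * _)%N]card_ord -sum_nat_const; apply: leq_sum => i _.
by rewrite mulnC leq_mul // ltnW.
Qed.

(** First moment: for fixed [y], each choice of [s] in [S] and of [h] determines the offset
    [s + <h, y>]. The range [n + d l n] is wide enough that every such offset occurs. *)
Lemma sum_card_affine_preim (n l d : nat) (S : {set 'I_n}) (X : {set {ffun 'I_d -> 'I_l}}) :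
  (#|X| * #|S| * n ^ d <=
   \sum_(z : 'I_(n + d * l * n) * {ffun 'I_d -> 'I_n}) #|X :&: affine_preim S z|)%N.
Proof.
have -> : (\sum_(z : 'I_(n + d * l * n) * {ffun 'I_d -> 'I_n}) #|X :&: affine_preim S z| =
    \sum_(y in X) #|[set z : 'I_(n + d * l * n) * {ffun 'I_d -> 'I_n} | y \in affine_preim S z]|)%N.
  rewrite (eq_bigr (fun z => \sum_(y in X) (y \in affine_preim S z))%N) => [|z _].
    rewrite exchange_big /=; apply: eq_bigr => y _.
    rewrite -sum1_card [RHS]big_mkcond /=; apply: eq_bigr => z _.
    by rewrite [z \in _]finset.in_set; case: (y \in _).
  rewrite -sum1_card big_mkcond [RHS]big_mkcond /=; apply: eq_bigr => y _.
  by rewrite finset.in_setI; do 2!case: (_ \in _).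
rewrite -mulnA -sum_nat_const; apply: leq_sum => y _.
have -> : (#|S| * n ^ d = #|finset.setX S [set: {ffun 'I_d -> 'I_n}]|)%N.
  by rewrite cardsX cardsT card_ffun !card_ord.
have hN (p : 'I_n * {ffun 'I_d -> 'I_n}) : (p.1 + inner p.2 y < n + d * l * n)%N.
  by have := inner_le p.2 y; have := ltn_ord p.1; lia.
pose g p := (Ordinal (hN p), p.2).
rewrite -(@card_imset _ _ g); last first.
  by move=> [s h] [s' h'] [/[swap] <- /addIn /val_inj ->].
apply/subset_leq_card/fintype.subsetP => t /imsetP[[s h]].
rewrite !inE /= andbT => sS ->; apply/existsP; exists s.
by rewrite sS /=.
Qed.

(* Since y1, y2, y3 are not collinear, some minor of their differences in
   coordinates i, j is nonzero, and z can be recovered from its values at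
   y1, y2, y3 and the entries of h outside {i, j}. The factor n ^ 2 counts
   arbitrary values written over the entries i, j of h. *)
Lemma card_affine_preim_sol (a1 a2 a3 a4 : int) (n l d N r : nat) (S : {set 'I_n})
    (y1 y2 y3 y4 : {ffun 'I_d -> 'I_l}) :
  a1 + a2 + a3 + a4 = 0 ->
  (\sum_i y1 i ^ 2 = r)%N -> (\sum_i y2 i ^ 2 = r)%N -> (\sum_i y3 i ^ 2 = r)%N ->
  y1 != y2 -> y1 != y3 -> y2 != y3 ->
  (forall i, a1 * (y1 i)%:Z + a2 * (y2 i)%:Z + a3 * (y3 i)%:Z + a4 * (y4 i)%:Z = 0) ->
  (#|[set z : 'I_N * {ffun 'I_d -> 'I_n} |
       [&& y1 \in affine_preim S z, y2 \in affine_preim S z,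
           y3 \in affine_preim S z & y4 \in affine_preim S z]]| * n ^ 2
    <= nsol a1 a2 a3 a4 S * n ^ d)%N.
Proof.
move=> a0 hr1 hr2 hr3 n12 n13 n23 hy.
case: n S => [|n] S; first by rewrite muln0.
pose y (w : {ffun 'I_d -> 'I_l}) i : int := (w i)%:Z.
have hsq (w : {ffun 'I_d -> 'I_l}) : (\sum_i w i ^ 2 = r)%N -> \sum_i y w i ^+ 2 = r%:Z.
  by move=> <-; rewrite -[RHS]natz natr_sum; apply: eq_bigr => i _; rewrite natrX natz.
have hne (w w' : {ffun 'I_d -> 'I_l}) : w != w' -> ~ y w =1 y w'.
  by move=> /eqP h h'; apply: h; apply/ffunP => i; apply: val_inj; case: (h' i).
have [i [j D]] := sphere_noncollinear _ _ _ _ _ (hsq _ hr1) (hsq _ hr2) (hsq _ hr3)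
   (hne _ _ n12) (hne _ _ n13) (hne _ _ n23).
have nij : i != j by apply: contraNneq D => ->; rewrite subrr.
set Z := [set z | _].
have ZP z : z \in Z -> [&& y1 \in affine_preim S z, y2 \in affine_preim S z,
    y3 \in affine_preim S z & y4 \in affine_preim S z] by rewrite finset.in_set.
(* Truncated subtraction and the default value of [inord] do no harm: by [sP], [s z w] is the true
   image whenever [w] lies in [affine_preim S z]. *)
pose s (z : 'I_N * {ffun 'I_d -> 'I_n.+1}) (w : {ffun 'I_d -> 'I_l}) : 'I_n.+1 := inord (z.1 - inner z.2 w).
have sP z w : w \in affine_preim S z -> s z w \in S /\ (s z w + inner z.2 w = z.1)%N.
  rewrite inE => /'exists_andP[t [tS /eqP ht]].
  suff -> : s z w = t by [].
  by rewrite /s -ht addnK inord_val.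
pose g (t : 'I_N * {ffun 'I_d -> 'I_n.+1} * ('I_n.+1 * 'I_n.+1)) :=
  ((s t.1 y1, s t.1 y2, s t.1 y3, s t.1 y4),
   [ffun k => if k == i then t.2.1 else if k == j then t.2.2 else t.1.2 k]).
pose Sol := [set x : 'I_n.+1 * 'I_n.+1 * 'I_n.+1 * 'I_n.+1 |
      [&& x.1.1.1 \in S, x.1.1.2 \in S, x.1.2 \in S, x.2 \in S &
          solE a1 a2 a3 a4 x.1.1.1 x.1.1.2 x.1.2 x.2]].
have innerZ (h : {ffun 'I_d -> 'I_n.+1}) (w : {ffun 'I_d -> 'I_l}) :
    (inner h w)%:Z = \sum_k (h k)%:Z * y w k.
  rewrite /inner -natz natr_sum; apply: eq_bigr => k _.
  by rewrite natrM !natz.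
have -> : (nsol a1 a2 a3 a4 S * n.+1 ^ d = #|finset.setX Sol [set: {ffun 'I_d -> 'I_n.+1}]|)%N.
  by rewrite cardsX cardsT card_ffun !card_ord.
have -> : (#|Z| * n.+1 ^ 2 = #|finset.setX Z [set: 'I_n.+1 * 'I_n.+1]|)%N.
  by rewrite cardsX cardsT card_prod !card_ord.
rewrite -(@card_in_imset _ _ g); last first.
  move=> [[x h] [p q]] [[x' h'] [p' q']]; rewrite !finset.in_setX !finset.in_setT !andbT.
  move=> /ZP/and4P[/sP[_ e1] /sP[_ e2] /sP[_ e3] _].
  move=> /ZP/and4P[/sP[_ e1'] /sP[_ e2'] /sP[_ e3'] _].
  rewrite /g /= => -[E1 E2 E3 E4] /ffunP F.
  have Fp : p = p' by have := F i; rewrite !ffunE eqxx.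
  have Fq : q = q' by have := F j; rewrite !ffunE eqxx eq_sym (negbTE nij).
  have Fk k : k != i -> k != j -> h k = h' k.
    by move=> ki kj; have := F k; rewrite !ffunE (negbTE ki) (negbTE kj).
  move: e1 e2 e3 e1' e2' e3'; rewrite /= E1 E2 E3 => e1 e2 e3 e1' e2' e3'.
  pose c k : int := (h k)%:Z - (h' k)%:Z.
  have cE (w : {ffun 'I_d -> 'I_l}) : (inner h w)%:Z - (inner h' w)%:Z = c i * y w i + c j * y w j.
    rewrite !innerZ -sumrB (bigD1 i) //= (bigD1 j) 1?eq_sym //= big1 ?addr0.
      by rewrite /c; ring.
    by move=> k /andP[ki kj]; rewrite Fk ?subrr.
  have d1 := cE y1; have d2 := cE y2; have d3 := cE y3.
  (* Equal images at [y1], [y2], [y3] make [(c i, c j)] a solution of a homogeneous 2 by 2 system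
     whose determinant is the minor in [D]; Cramer's rule gives [c i = c j = 0]. *)
  have A1 : c i * (y y2 i - y y1 i) + c j * (y y2 j - y y1 j) = 0 by lia.
  have A2 : c i * (y y3 i - y y1 i) + c j * (y y3 j - y y1 j) = 0 by lia.
  have ci : c i = 0.
    apply/eqP; have /eqP : c i * ((y y2 i - y y1 i) * (y y3 j - y y1 j) - (y y2 j - y y1 j) * (y y3 i - y y1 i)) = 0.
      transitivity ((c i * (y y2 i - y y1 i) + c j * (y y2 j - y y1 j)) * (y y3 j - y y1 j) -
       (c i * (y y3 i - y y1 i) + c j * (y y3 j - y y1 j)) * (y y2 j - y y1 j)); first by ring.
      by rewrite A1 A2; ring.
    by rewrite mulf_eq0 (negbTE D) orbF.
  have cj : c j = 0.
    apply/eqP; have /eqP : c j * ((y y2 i - y y1 i) * (y y3 j - y y1 j) - (y y2 j - y y1 j) * (y y3 i - y y1 i)) = 0.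
      transitivity ((c i * (y y3 i - y y1 i) + c j * (y y3 j - y y1 j)) * (y y2 i - y y1 i) -
       (c i * (y y2 i - y y1 i) + c j * (y y2 j - y y1 j)) * (y y3 i - y y1 i)); first by ring.
      by rewrite A1 A2; ring.
    by rewrite mulf_eq0 (negbTE D) orbF.
  have hh : h = h'.
    apply/ffunP => k; have [->|ki] := eqVneq k i; first by apply: val_inj; move/eqP: ci; rewrite /c subr_eq0 => /eqP[].
    have [->|kj] := eqVneq k j; first by apply: val_inj; move/eqP: cj; rewrite /c subr_eq0 => /eqP[].
    exact: Fk.
  have xx : x = x' by apply: val_inj; rewrite /= -e1 -e1' hh.
  by rewrite hh xx Fp Fq.
apply/subset_leq_card/fintype.subsetP => t /imsetP[[[x h] [p q]]].
rewrite finset.in_setX finset.in_setT andbT => /ZP/and4P[/sP[S1 e1] /sP[S2 e2] /sP[S3 e3] /sP[S4 e4]] ->.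
rewrite finset.in_setX finset.in_setT andbT inE /= S1 S2 S3 S4 /= /solE /elt.
have ss w : (s (x, h) w + inner h w = x)%N -> ((s (x,h) w).+1)%:Z = x%:Z + 1 - \sum_k (h k)%:Z * y w k.
  by rewrite -innerZ; lia.
rewrite (ss _ e1) (ss _ e2) (ss _ e3) (ss _ e4).
(* The zero coefficient sum cancels the common shift [x + 1], and the coordinatewise relation [hy]
   cancels the linear part. *)
apply/eqP; transitivity ((a1 + a2 + a3 + a4) * (x%:Z + 1) -
   \sum_k (h k)%:Z * (a1 * y y1 k + a2 * y y2 k + a3 * y y3 k + a4 * y y4 k)).
  under [X in _ = _ - X]eq_bigr => k _ do
    rewrite !mulrDr ![(h k)%:Z * (_ * _)]mulrCA.
  by rewrite !big_split /= -!mulr_sumr; ring.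
by rewrite a0 mul0r sub0r big1 ?oppr0 // => k _; rewrite hy mulr0.
Qed.

(** * Encoding grid points as integers *)

Definition coord_sol (a1 a2 a3 a4 : int) {l d : nat} (y1 y2 y3 y4 : {ffun 'I_d -> 'I_l}) : bool :=
  [forall i, a1 * (y1 i)%:Z + a2 * (y2 i)%:Z + a3 * (y3 i)%:Z + a4 * (y4 i)%:Z == 0].

Definition sum_abs (a1 a2 a3 a4 : int) : nat := (`|a1| + `|a2| + `|a3| + `|a4|)%N.

Definition encode {l d : nat} (b : nat) (y : {ffun 'I_d -> 'I_l}) : nat :=
  (\sum_i y i * b ^ i)%N.

Lemma encodeE {l d : nat} (b : nat) (y : {ffun 'I_d -> 'I_l}) :
  (encode b y)%:Z = \sum_i (y i)%:Z * (b ^ i)%:Z.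
Proof. by rewrite /encode -natz natr_sum; apply: eq_bigr => i _; rewrite natrM !natz. Qed.

Lemma encode_inj {l d b : nat} : (l <= b)%N -> injective (@encode l d b).
Proof.
move=> lb y y' e; apply/ffunP => i; apply: val_inj.
suff : (y i)%:Z - (y' i)%:Z = 0 by move/eqP; rewrite subr_eq0 => /eqP[].
move: i; apply: (@base_expansion_eq0 b) => [k|].
  by have := ltn_ord (y k); have := ltn_ord (y' k); lia.
under eq_bigr => k _ do rewrite mulrBl.
by rewrite sumrB -!encodeE e subrr.
Qed.

(** There are no carries: digits are at most [l - 1], so each coordinate combination is at most
    [sum_abs] times [l - 1] in absolute value, strictly below [b]. *)
Lemma encode_sol (a1 a2 a3 a4 : int) (l d : nat) (y1 y2 y3 y4 : {ffun 'I_d -> 'I_l}) :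
  a1 != 0 ->
  let b := (sum_abs a1 a2 a3 a4 * l)%N in
  a1 * (encode b y1)%:Z + a2 * (encode b y2)%:Z + a3 * (encode b y3)%:Z
    + a4 * (encode b y4)%:Z = 0 -> coord_sol a1 a2 a3 a4 y1 y2 y3 y4.
Proof.
move=> a1n b e; apply/forallP => i; apply/eqP; move: i.
apply: (@base_expansion_eq0 b) => [i|].
  have l1 := ltn_ord (y1 i); have l2 := ltn_ord (y2 i).
  have l3 := ltn_ord (y3 i); have l4 := ltn_ord (y4 i).
  have H (a : int) (x : nat) : (x < l)%N -> (`|(a * x%:Z)%R| <= `|a| * l.-1)%N.
    by move=> xl; rewrite abszM leq_mul2l; apply/orP; right; lia.
  have := H a1 _ l1; have := H a2 _ l2; have := H a3 _ l3; have := H a4 _ l4.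
  rewrite /b /sum_abs; have E k : (k * l = k + k * l.-1)%N by rewrite -mulnS prednK //; lia.
  by rewrite E !mulnDl; lia.
rewrite -[RHS]e !encodeE !mulr_sumr -!big_split; apply: eq_bigr => i _ /=.
by ring.
Qed.

(** * The deletion argument, averaged over affine maps *)

(** For every map, deletion gives [#|AA z| <= #|Q z| + m]. Summing over [z], the left side is at
    least [#|X| #|S| n^d], and each of at most [#|X|^4] quadruples contributes at most
    [nsol n^d / n^2]. The factor [1 + d l] comes from the number of offsets. *)
Lemma nsol_lower_bound (a1 a2 a3 a4 : int) (n l d m r : nat)
    (S : {set 'I_n}) (X : {set {ffun 'I_d -> 'I_l}}) :
  a1 != 0 -> a1 + a2 + a3 + a4 = 0 ->
  (forall y, y \in X -> \sum_i y i ^ 2 = r)%N ->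
  (forall A : {set 'I_((sum_abs a1 a2 a3 a4 * l) ^ d)},
     (m < #|A|)%N -> has_distinct_sol a1 a2 a3 a4 A) ->
  (#|X| * #|S| * n ^ 2 <= #|X| ^ 4 * nsol a1 a2 a3 a4 S + m * n ^ 3 * (1 + d * l))%N.
Proof.
move=> a1n a0 Xr hA.
case: (posnP n) => [n0|n_gt0]; first by rewrite [(n ^ 2)%N](_ : _ = 0)%N ?muln0 ?n0.
set b := (sum_abs a1 a2 a3 a4 * l)%N in hA *.
have K0 : (0 < sum_abs a1 a2 a3 a4)%N by rewrite /sum_abs; lia.
have lb : (l <= b)%N by rewrite /b leq_pmull.
set N := (n + d * l * n)%N.
pose Y := {ffun 'I_d -> 'I_l}.
pose AA (z : 'I_N * {ffun 'I_d -> 'I_n}) := X :&: affine_preim S z.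
pose good (q : Y * Y * Y * Y) :=
  [&& q.1.1.1 != q.1.1.2, q.1.1.1 != q.1.2, q.1.1.2 != q.1.2 &
      coord_sol a1 a2 a3 a4 q.1.1.1 q.1.1.2 q.1.2 q.2].
pose hit z (q : Y * Y * Y * Y) :=
  [&& q.1.1.1 \in AA z, q.1.1.2 \in AA z, q.1.2 \in AA z & q.2 \in AA z].
pose Q z := [set q | good q && hit z q].
(* Delete the first point of every solution. *)
have del z : (#|AA z| <= #|Q z| + m)%N.
  rewrite leqNgt; apply/negP => hlt.
  pose A' := AA z :\: [set q.1.1.1 | q in Q z].
  have cA' : (m < #|A'|)%N.
    have c1 := cardsID [set q.1.1.1 | q in Q z] (AA z).
    have c2 : (#|AA z :&: [set q.1.1.1 | q in Q z]| <= #|Q z|)%N.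
      by apply: (leq_trans (subset_leq_card (subsetIr _ _))); apply: leq_imset_card.
    by rewrite -(ltn_add2l #|AA z :&: [set q.1.1.1 | q in Q z]|) c1 (leq_ltn_trans _ hlt) // leq_add2r.
  have elt_b (y : Y) : (encode b y < b ^ d)%N.
    by apply: base_expansion_lt => i; apply: leq_trans lb.
  pose e (y : Y) := Ordinal (elt_b y).
  have e_inj : injective e by move=> y y' [/(encode_inj lb)].
  have [|x1 [x2 [x3 [x4 []]]]] := hA [set e y | y in A']; first by rewrite card_imset.
  move=> /and4P[/imsetP[y1 A1 ->] /imsetP[y2 A2 ->] /imsetP[y3 A3 ->] /imsetP[y4 A4 ->]].
  rewrite !(inj_eq e_inj) => /and5P[n12 n13 n14 n23 _].
  rewrite /solE /elt /= => /eqP sol.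
  have hit0 : hit z (y1, y2, y3, y4).
    by move: A1 A2 A3 A4; rewrite /A' !finset.in_setD /hit /=; do 4!(case/andP => _ ->).
  have good0 : good (y1, y2, y3, y4).
    rewrite /good /= n12 n13 n23 /=; apply: encode_sol => //; rewrite -/b.
    (* [elt] counts from 1 and [encode] from 0; the zero coefficient sum absorbs the difference. *)
    have shift (u1 u2 u3 u4 : nat) : a1 * u1%:Z + a2 * u2%:Z + a3 * u3%:Z + a4 * u4%:Z =
        a1 * u1.+1%:Z + a2 * u2.+1%:Z + a3 * u3.+1%:Z + a4 * u4.+1%:Z.
      by rewrite !intS !mulrDr !mulr1; lia.
    by rewrite shift; exact: sol.
  move: A1; rewrite /A' finset.in_setD => /andP[/negP + _]; apply.
  by apply/imsetP; exists (y1, y2, y3, y4); rewrite // finset.in_set good0.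
have sumQ : ((\sum_z #|Q z|) * n ^ 2 <= #|X| ^ 4 * (nsol a1 a2 a3 a4 S * n ^ d))%N.
  pose X4 := finset.setX (finset.setX (finset.setX X X) X) X.
  have -> : (\sum_z #|Q z| = \sum_(q in X4) #|[set z | good q && hit z q]|)%N.
    transitivity (\sum_z \sum_(q in X4) (good q && hit z q))%N.
      apply: eq_bigr => z _; rewrite -sum1_card big_mkcond [RHS]big_mkcond /=.
      apply: eq_bigr => -[[[q1 q2] q3] q4] _; rewrite finset.in_set !finset.in_setX /=.
      rewrite /hit /= !finset.in_setI.
      by do 4!(case: (_ \in X); rewrite ?andbF //=); case: (_ && _).
    rewrite exchange_big /=; apply: eq_bigr => q _.
    rewrite -sum1_card [RHS]big_mkcond /=; apply: eq_bigr => z _.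
    by rewrite [z \in _]finset.in_set; case: (_ && _).
  have -> : (#|X| ^ 4 = #|X4|)%N by rewrite !cardsX; ring.
  rewrite big_distrl /= -sum_nat_const; apply: leq_sum => -[[[q1 q2] q3] q4].
  rewrite !finset.in_setX /= => /andP[/andP[/andP[X1 X2] X3] X4'].
  have [/and4P[/= n12 n13 n23 /forallP cs]|ng] := boolP (good (q1, q2, q3, q4)); last first.
    by rewrite (_ : [set z | _] = finset.set0) ?cards0 //; apply/finset.setP => z; rewrite !inE.
  apply: leq_trans (@card_affine_preim_sol a1 a2 a3 a4 n l d N r S q1 q2 q3 q4 a0
    (Xr _ X1) (Xr _ X2) (Xr _ X3) n12 n13 n23 (fun i => eqP (cs i))).
  rewrite leq_mul2r; apply/orP; right; apply/subset_leq_card/fintype.subsetP => z.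
  rewrite 2![z \in _]finset.in_set /hit /AA /= => /and4P[].
  by do 4!(move=> /finset.setIP[_ ->]).
have tot := sum_card_affine_preim n l d S X.
have {del} : (\sum_z #|AA z| <= \sum_z (#|Q z| + m))%N by apply: leq_sum => z _; apply: del.
rewrite big_split /= sum_nat_const card_prod card_ffun !card_ord => tot2.
have nd0 : (0 < n ^ d)%N by rewrite expn_gt0 n_gt0.
rewrite -(leq_pmul2r nd0).
have -> : (#|X| * #|S| * n ^ 2 * n ^ d = #|X| * #|S| * n ^ d * n ^ 2)%N by ring.
apply: (leq_trans (leq_mul (leq_trans tot tot2) (leqnn (n ^ 2)))).
rewrite !mulnDl; apply: leq_add; first by rewrite -[leqRHS]mulnA.
by rewrite /N leq_eqVlt; apply/orP; left; apply/eqP; ring.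
Qed.

(** The density given to [RE_le] is tuned so that, as [#|X|] is at least [l^d / (1 + d l^2)], the
    term with [m] in [nsol_lower_bound] takes at most half of the main term. The other half yields
    the bound through [#|X| <= l^d]. *)
Lemma nsol_ge (R : realType) (a1 a2 a3 a4 : int) (eps : R) (n l d : nat) (S : {set 'I_n}) :
  a1 != 0 -> a1 + a2 + a3 + a4 = 0 -> (0 < l)%N -> 0 < eps ->
  let K := sum_abs a1 a2 a3 a4 in
  RE_le a1 a2 a3 a4
    (eps / (2 * (K ^ d)%:R * (1 + d * l)%:R * (1 + d * l ^ 2)%:R)) ((K * l) ^ d)%:R ->
  eps * n%:R <= #|S|%:R ->
  eps * n%:R ^+ 3 <= 2 * (l%:R ^+ d) ^+ 3 * (nsol a1 a2 a3 a4 S)%:R.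
Proof.
move=> a1n a0 l0 e0 K [R0 [R0M hR]] hS.
set delta := eps / _ in hR.
have [r] := sphere_pigeonhole d l; set X := [set y | _] => hX.
set M := ((K * l) ^ d)%N in R0M hR.
have K0 : (0 < K)%N by rewrite /K /sum_abs; lia.
have ld0 : (0 < l ^ d)%N by rewrite expn_gt0 l0.
have X0 : (0 < #|X|)%N by case: #|X| hX => [|//]; rewrite mul0n; lia.
have Xl : (#|X| <= l ^ d)%N.
  by apply: (leq_trans (max_card _)); rewrite card_ffun !card_ord.
have Kd0 : (0 < K ^ d)%N by rewrite expn_gt0 K0.
have D0 : 0 < 2 * (K ^ d)%:R * (1 + d * l)%:R * (1 + d * l ^ 2)%:R :> R.
  by rewrite !mulr_gt0 ?ltr0n.
have d0 : 0 < delta by rewrite divr_gt0.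
(* More than [m] elements means at least [delta M] elements, so sparsity applies at length [M]. *)
pose m := Num.truncn (delta * M%:R).
have hA (A : {set 'I_M}) : (m < #|A|)%N -> has_distinct_sol a1 a2 a3 a4 A.
  move=> mA; apply: hR; first by rewrite -(ler_nat R).
  by apply/ltW/(lt_le_trans (truncnS_gt _)); rewrite ler_nat.
have Xr y : y \in X -> (\sum_i y i ^ 2 = r)%N by rewrite finset.in_set => /eqP.
have := @nsol_lower_bound a1 a2 a3 a4 n l d m r S X a1n a0 Xr hA.
rewrite -(ler_nat R) natrD !(natrX, natrM) => main.
have mM : m%:R <= delta * M%:R by rewrite truncn_le mulr_ge0 // ltW.
move: hX Xl; rewrite -(ler_nat R) -[(#|X| <= _)%N](ler_nat R) natrM !natrX => hX Xl.
have dM : delta * M%:R * (2 * (1 + d * l)%:R * (1 + d * l ^ 2)%:R) = eps * l%:R ^+ d.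
  have DV := divff (lt0r_neq0 D0).
  rewrite /M expnMn natrM (natrX _ l) -[RHS]mulr1 -[X in _ = _ * X]DV /delta.
  have aux (A U V B z : R) :
      eps * z * (A * B) * (2 * U * V) = eps * B * (2 * A * U * V * z) by ring.
  exact: aux.
move: X0; rewrite -(ltr0n R) => X0.
set x := #|X|%:R in main hX Xl X0; set L := l%:R ^+ d in hX Xl dM *.
set u := (1 + d * l)%:R in main dM; set v := (1 + d * l ^ 2)%:R in hX dM.
set T := (nsol _ _ _ _ _)%:R in main *; set s := #|S|%:R in main hS.
set N := n%:R in main hS *.
have u0 : 0 < u by rewrite ltr0n.
have v0 : 0 < v by rewrite ltr0n.
have T0 : 0 <= T by rewrite ler0n.
have N0 : 0 <= N by rewrite ler0n.
have h1 : 2 * (m%:R * u) <= eps * x.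
  rewrite -(ler_pM2r v0) -mulrA.
  apply: (@le_trans _ _ (eps * L)); last by rewrite -mulrA ler_pM2l.
  rewrite -dM; have : m%:R * (2 * u * v) <= delta * M%:R * (2 * u * v).
    by rewrite ler_pM2r // !mulr_gt0.
  by apply: le_trans; rewrite le_eqVlt; apply/orP; left; apply/eqP; ring.
have h2 : x * (eps * N) * N ^+ 2 <= x * s * N ^+ 2.
  by rewrite ler_wpM2r ?exprn_ge0 // ler_pM2l.
have h3 : 2 * (m%:R * u) * N ^+ 3 <= eps * x * N ^+ 3.
  by rewrite ler_wpM2r ?exprn_ge0.
have h4 : x * (eps * N ^+ 3) <= x * (2 * x ^+ 3 * T).
  have e1 : x * (2 * x ^+ 3 * T) = 2 * (x ^+ 4 * T) by ring.
  have e2 : x * (eps * N) * N ^+ 2 = x * (eps * N ^+ 3) by ring.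
  have e3 : 2 * (m%:R * u) * N ^+ 3 = 2 * (m%:R * N ^+ 3 * u) by ring.
  have e4 : eps * x * N ^+ 3 = x * (eps * N ^+ 3) by ring.
  rewrite e1; rewrite e2 in h2; rewrite e3 e4 in h3.
  lra.
rewrite ler_pM2l // in h4; apply: (le_trans h4).
rewrite ler_wpM2r // ler_pM2l //; apply: (lerXn2r _ _ _ Xl); rewrite nnegrE ?(ltW X0) //.
exact: (ltW (lt_le_trans X0 Xl)).
Qed.

(** * Preparations for the exponent and the lower limit *)

(** As [a4] is nonzero, three entries determine the fourth. This keeps the ratios in [[0, 1]], as
    [limn_inf_ge] requires. *)
Lemma nsol_le (a1 a2 a3 a4 : int) (n : nat) (S : {set 'I_n}) :
  a4 != 0 -> (nsol a1 a2 a3 a4 S <= n ^ 3)%N.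
Proof.
move=> a4n; have -> : (n ^ 3 = #|{: 'I_n * 'I_n * 'I_n}|)%N.
  by rewrite !card_prod card_ord; ring.
rewrite /nsol -(@card_in_imset _ _ fst) ?max_card //.
move=> [[[x1 x2] x3] x4] [[[y1 y2] y3] y4]; rewrite !inE /=.
move=> /and5P[_ _ _ _ /eqP h] /and5P[_ _ _ _ /eqP h'] [e1 e2 e3].
move: h'; rewrite -e1 -e2 -e3 => h'; congr (_, _); apply: val_inj.
have /(mulfI a4n) : a4 * elt x4 = a4 * elt y4 by lia.
by move=> -[].
Qed.

(* A singleton has no distinct solution, so R_E(eps) is at least about 1/eps. *)
Lemma sparse_exponent_ge (R : realType) (a1 a2 a3 a4 : int) (C e0 : R) : 0 < e0 ->
  (forall eps : R, 0 < eps -> eps < e0 -> RE_le a1 a2 a3 a4 eps (eps `^ (- C))) ->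
  2^-1 <= C.
Proof.
move=> e00 h; rewrite leNgt; apply/negP => hC.
pose eps := Num.min (e0 / 2) (16^-1).
have eps0 : 0 < eps by rewrite lt_min; apply/andP; split; lra.
have epsl : eps < e0 by rewrite gt_min; apply/orP; left; lra.
have eps16 : eps <= 16^-1 by rewrite ge_min lexx orbT.
(* If [C < 1/2] then [R0 <= eps^(-1/2)], so [eps (R0 + 1) <= eps^(1/2) + eps], below 1 for
   [eps <= 1/16]: a singleton in [[R0 + 1]] would count as dense. *)
have [R0 [R0le /(_ R0.+1 (leqnSn _) [set ord0])]] := h eps eps0 epsl.
case.
  rewrite cards1 -natr1.
  pose x := eps `^ 2^-1.
  have x0 : 0 < x by rewrite powR_gt0.
  have xx : x * x = eps.
    rewrite /x -powRD ?(gt_eqF eps0) ?implybT // (_ : 2^-1 + 2^-1 = 1 :> R) ?powRr1 ?ltW //.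
    by lra.
  have R0x : R0%:R <= x^-1.
    apply: (le_trans R0le); rewrite -powRN; apply: ger_powR; last by lra.
    by rewrite eps0; lra.
  have : eps * R0%:R <= x.
    rewrite -[leRHS](mulfK (lt0r_neq0 x0)) xx.
    by rewrite ler_pM2l.
  nra.
move=> x1 [x2 [x3 [x4 [/and4P[]]]]]; rewrite !inE => /eqP -> /eqP -> _ _.
by rewrite eqxx.
Qed.

(* Boundedness above is needed: limn_inf is a junk value when the sequence of
   infima diverges. *)
Lemma limn_inf_ge (R : realType) (u : R^nat) (c : R) :
  (forall n, 0 <= u n <= 1) -> (forall n, (0 < n)%N -> c <= u n) -> c <= limn_inf u.
Proof.
move=> u01 cu.
have lb n : has_lbound (sdrop u n) by exists 0 => _ [k _ <-]; case/andP: (u01 k).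
have cv : cvgn (infs u).
  apply: nondecreasing_is_cvgn.
    by apply: nondecreasing_infs; exists 0 => _ [k _ <-]; case/andP: (u01 k).
  exists 1 => _ [n _ <-]; apply: (@le_trans _ _ (u n)).
    by apply: (ge_inf (lb n)); exists n => /=.
  by case/andP: (u01 n).
apply: limr_ge => //; exists 1%N => // n /= n1.
apply: lb_le_inf; first by exists (u n), n => /=.
by move=> _ [k /= nk <-]; apply: cu; apply: leq_trans nk.
Qed.

(** * Choice of the dimension and the side length *)

(** Take [d > 12 C] and [l] the integer part of [t = eps^(-2C/d)]. The denominator of [delta] is
    [O(t^3)], hence [O(eps^(-1/2))], so [delta^(-C)] is [O(eps^(-3C/2))], while [l^d] has order
    [eps^(-2C)]. *)
Lemma sample_size (R : realType) (K : nat) (C e0 : R) : (0 < K)%N -> 0 < C -> 0 < e0 ->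
  exists2 e1 : R, 0 < e1 & forall eps : R, 0 < eps -> eps < e1 ->
  exists l d : nat,
    let delta := eps / (2 * (K ^ d)%:R * (1 + d * l)%:R * (1 + d * l ^ 2)%:R) in
    [/\ (0 < l)%N, 0 < delta < e0, delta `^ (- C) <= ((K * l) ^ d)%:R
      & (l%:R ^+ d) ^+ 3 <= eps `^ (- (6 * C))].
Proof.
move=> K0 C0 e00.
pose d := (Num.truncn (12 * C)).+1.
have dC : 12 * C < d%:R by exact: truncnS_gt.
have d0 : 0 < d%:R :> R by rewrite ltr0n.
have Kd0 : (0 < K ^ d)%N by rewrite expn_gt0 K0.
pose c : R := (2 * K ^ d * (1 + d) ^ 2)%:R.
have c0 : 0 < c by rewrite ltr0n !muln_gt0 Kd0.
(* [w] collects the constants: [2^d] from rounding [t] down to [l >= t / 2], and [c^C] from the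
   denominator. The spare factor [eps^(C/2)] absorbs [w] once [eps] is below [w^(-2/C)]. *)
pose w := 2 ^+ d * c `^ C.
have w0 : 0 < w by rewrite mulr_gt0 ?exprn_gt0 ?powR_gt0.
exists (Num.min (Num.min 1 e0) (w `^ (- (2 / C)))).
  by rewrite !lt_min ltr01 e00 powR_gt0.
move=> eps eps0; rewrite !lt_min => /andP[/andP[eps1 epse0] epsw].
have pD (x y : R) : eps `^ (x + y) = eps `^ x * eps `^ y.
  by rewrite powRD // (gt_eqF eps0) implybT.
have epsI : 0 < eps <= 1 by rewrite eps0 ltW.
have weps : w * eps `^ (C / 2) <= 1.
  have : eps `^ (C / 2) <= (w `^ (- (2 / C))) `^ (C / 2).
    apply: ge0_ler_powR; rewrite ?nnegrE ?powR_ge0 ?ltW //.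
    by rewrite divr_gt0.
  rewrite -powRrM (_ : - (2 / C) * (C / 2) = -1); last by field; rewrite gt_eqF.
  rewrite powR_inv1 ?(ltW w0) // => h.
  by rewrite -ler_pdivlMl // mulr1.
pose t := eps `^ (- (2 * C / d%:R)).
have t1 : 1 <= t.
  rewrite -(powRr0 eps); apply: ger_powR => //.
  by rewrite oppr_le0 divr_ge0 // ltW // mulr_gt0.
have t0 : 0 < t by lra.
have td : t ^+ d = eps `^ (- (2 * C)).
  rewrite -powR_mulrn ?ltW // -powRrM; congr (_ `^ _).
  by field; rewrite gt_eqF.
pose l := Num.truncn t.
have lt : l%:R <= t by rewrite truncn_le ltW.
have tl : t < l.+1%:R by exact: truncnS_gt.
have l0 : (0 < l)%N by rewrite truncn_gt0.
have l1 : 1 <= l%:R :> R by rewrite ler1n.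
have t2l : t / 2 <= l%:R by rewrite -natr1 in tl; lra.
pose D : R := 2 * (K ^ d)%:R * (1 + d * l)%:R * (1 + d * l ^ 2)%:R.
have D1 : 1 <= D.
  by rewrite /D -!natrM ler1n !muln_gt0 Kd0.
have D0 : 0 < D by lra.
have Dc : D <= c * t ^+ 3.
  apply: (@le_trans _ _ (c * l%:R ^+ 3)).
    rewrite /D /c -natrX -!natrM ler_nat.
    have -> : (2 * K ^ d * (1 + d) ^ 2 * l ^ 3 = (2 * K ^ d) * ((1 + d) * l) * ((1 + d) * l ^ 2))%N by ring.
    by rewrite !leq_mul // mulnDl leq_add2r mul1n // expn_gt0 l0.
  by rewrite ler_pM2l //; apply: lerXn2r; rewrite ?nnegrE ?ler0n ?(ltW t0).
exists l, d; rewrite -/D; split => //.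
- by rewrite divr_gt0 //= (le_lt_trans _ epse0) // ler_pdivrMr // ler_peMr // ltW.
- apply: (@le_trans _ _ (c `^ C * eps `^ (- (C / 2)) * eps `^ (- C))).
    rewrite powRM ?invr_ge0 ?(ltW D0) ?(ltW eps0) // -(powR_inv1 (ltW D0)) -powRrM.
    rewrite mulN1r opprK mulrC.
    rewrite ler_pM2r ?powR_gt0 //.
    apply: (@le_trans _ _ ((c * t ^+ 3) `^ C)).
      by apply: ge0_ler_powR; rewrite ?nnegrE ?mulr_ge0 ?exprn_ge0 ?(ltW C0) ?(ltW D0) ?(ltW c0) ?(ltW t0).
    rewrite powRM ?exprn_ge0 ?(ltW c0) ?(ltW t0) // ler_pM2l ?powR_gt0 //.
    (* The exponents compare as [6 C^2 / d <= C / 2], that is [12 C <= d]. *)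
    rewrite -powR_mulrn ?(ltW t0) // -!powRrM; apply: ger_powR => //.
    rewrite !mulNr lerN2 mulrAC ler_pdivrMr // [leRHS]mulrAC.
    nra.
  have hw : w * eps `^ (- (C / 2)) * eps `^ (- C) <= eps `^ (- (2 * C)).
    have -> : - (C / 2) = C / 2 + - C by field.
    have -> : - (2 * C) = - C + - C by ring.
    rewrite !pD mulrA -[leRHS]mul1r [leRHS]mulrA ler_pM2r ?powR_gt0 // ler_pM2r ?powR_gt0 //.
  apply: (@le_trans _ _ ((t / 2) ^+ d)).
    rewrite expr_div_n td ler_pdivlMr ?exprn_gt0 //.
    by apply: le_trans hw; rewrite /w le_eqVlt; apply/orP; left; apply/eqP; ring.
  rewrite natrX; apply: lerXn2r; rewrite ?nnegrE ?divr_ge0 ?ler0n ?(ltW t0) //.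
  by apply: (le_trans t2l); rewrite ler_nat leq_pmull.
- have -> : eps `^ (- (6 * C)) = (t ^+ d) ^+ 3.
    rewrite td -powR_mulrn ?powR_ge0 // -powRrM; congr (_ `^ _); ring.
  by do 2!(apply: lerXn2r; rewrite ?nnegrE ?exprn_ge0 ?ler0n ?(ltW t0) //).
Qed.

(** * From the counting bound to the lower limit *)

Theorem theorem1 (R : realType) (a1 a2 a3 a4 : int) (C : R) :
  a1 != 0 -> a2 != 0 -> a3 != 0 -> a4 != 0 ->
  a1 + a2 + a3 + a4 = 0 ->
  0 < C ->
  (exists2 e0 : R, 0 < e0 &
     forall eps : R, 0 < eps -> eps < e0 -> RE_le a1 a2 a3 a4 eps (eps `^ (- C))) ->
  exists2 e1 : R, 0 < e1 &
     forall eps : R, 0 < eps -> eps < e1 ->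
       2^-1 * eps `^ (8 * C) <= Rstar a1 a2 a3 a4 eps.
Proof.
move=> a1n _ _ a4n a0 C0 [e0 e00 sparse].
have C2 := sparse_exponent_ge _ _ _ _ _ _ _ e00 sparse.
have K0 : (0 < sum_abs a1 a2 a3 a4)%N by rewrite /sum_abs; lia.
have [e1 e10 he1] := sample_size R _ C e0 K0 C0 e00.
exists (Num.min 1 e1); first by rewrite lt_min ltr01.
move=> eps eps0; rewrite lt_min => /andP[eps1 epse1].
have [l [d [l0 /andP[delta0 deltae] hM hl]]] := he1 eps eps0 epse1.
(* The full set qualifies since [eps <= 1], so each infimum is over a nonempty set and is not a
   default value. *)
have dense n : (exists2 S : {set 'I_n}, eps * n%:R <= #|S|%:R & True).
  by exists [set: 'I_n]; rewrite // cardsT card_ord ler_piMl ?ler0n ?ltW.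
have ratio0 n (S : {set 'I_n}) : 0 <= (nsol a1 a2 a3 a4 S)%:R / n%:R ^+ 3 :> R.
  by rewrite divr_ge0 ?exprn_ge0 ?ler0n.
apply: limn_inf_ge => [n|n n0].
  have [S hS _] := dense n; apply/andP; split.
    apply: lb_le_inf; first by eexists; exists S; [exact: hS|reflexivity].
    by move=> _ [S' _ <-]; exact: ratio0.
  apply: (@le_trans _ _ ((nsol a1 a2 a3 a4 S)%:R / n%:R ^+ 3)).
    apply: ge_inf; last by exists S.
    by exists 0 => _ [S' _ <-]; exact: ratio0.
  (* At [n = 0] the ratio is 0, since the inverse of 0 is 0. *)
  have [n0|n0] := posnP n; first by rewrite [X in _ / X](_ : _ = 0) ?invr0 ?mulr0 ?n0 ?expr0n.
  by rewrite ler_pdivrMr ?exprn_gt0 ?ltr0n // mul1r -natrX ler_nat nsol_le.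
apply: lb_le_inf.
  by have [S hS _] := dense n; eexists; exists S; [exact: hS|reflexivity].
move=> _ [S /= hS <-].
rewrite ler_pdivlMr ?exprn_gt0 ?ltr0n //.
have RE : RE_le a1 a2 a3 a4
    (eps / (2 * (sum_abs a1 a2 a3 a4 ^ d)%:R * (1 + d * l)%:R * (1 + d * l ^ 2)%:R))
    ((sum_abs a1 a2 a3 a4 * l) ^ d)%:R.
  by have [R0 [R0le hR0]] := sparse _ delta0 deltae; exists R0; split=> //; apply: le_trans hM.
have := @nsol_ge R a1 a2 a3 a4 eps n l d S a1n a0 l0 eps0 RE hS.
set T := (nsol _ _ _ _ _)%:R; set N := n%:R ^+ 3 => h.
have T0 : 0 <= T by rewrite ler0n.
have N0 : 0 <= N by rewrite exprn_ge0 ?ler0n.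
have h2 : eps * N <= 2 * eps `^ (- (6 * C)) * T.
  by apply: (le_trans h); rewrite ler_wpM2r // ler_pM2l.
have p0 : 0 < eps `^ (6 * C) by rewrite powR_gt0.
have h3 : eps `^ (6 * C) * eps * N <= 2 * T.
  by rewrite -mulrA -ler_pdivlMl // -powRN (le_trans h2) // mulrCA mulrA.
(* [C >= 1/2] gives [6 C + 1 <= 8 C], turning the extra factor [eps] into a power with exponent
   proportional to [C]. *)
have h4 : eps `^ (8 * C) <= eps `^ (6 * C) * eps.
  rewrite -[X in _ <= _ * X](powRr1 (ltW eps0)) -powRD ?(gt_eqF eps0) ?implybT //.
  apply: ger_powR; first by rewrite eps0 ltW.
  by lra.
have : eps `^ (8 * C) * N <= eps `^ (6 * C) * eps * N by rewrite ler_wpM2r.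
lra.
Qed.
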